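(* Let $R$ be a local (not necessarily Noetherian) one-dimensional integral domain with maximal ideal $M$ and let $E:=(M:M)$. The following statements are equivalent: (i) $R$ is stable (equivalently, strongly stable); (ii) $R$ is Clifford regular and $M$ is a stable ideal; (iii) $R$ is Clifford regular and each maximal ideal of $E$ is divisorial (as an ideal of $E$); (iv) $R$ is Clifford regular and each $t_E$-maximal ideal of $E$ is divisorial (as an ideal of $E$).
   Context: For an integral domain $R$ with field of fractions $K$, an ideal means a nonzero fractional ideal, and $(J:I)=\{x\in K: xI\subseteq J\}$. For an ideal $I$, $E(I):=(I:I)$ is its endomorphism ring, an overring of $R$. $I$ is stable if $I$ is invertible as an ideal of $E(I)$, and strongly stable if $I$ is principal as an ideal of $E(I)$. $R$ is stable (respectively, strongly stable) if every ideal of $R$ is. $R$ is Clifford regular if for every ideal $I$ there is an ideal $J$ of $R$ with $I=I^2J$. For a domain $E$ and an ideal $I$ of $E$, $I^{v_E}=(E:(E:I))$; $I$ is divisorial if $I=I^{v_E}$. $I^{t_E}=\bigcup\{J^{v_E}: J\subseteq I \text{ a finitely generated ideal of }E\}$; $I$ is a $t_E$-ideal if $I=I^{t_E}$, and a $t_E$-maximal ideal is a maximal element of the set of proper integral $t_E$-ideals of $E$. *)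

(* Defs.v *)
From HB Require Import structures.
From mathcomp Require Import all_boot all_algebra.
From mathcomp Require Import boolp classical_sets.

Set Implicit Arguments.
Unset Strict Implicit.
Unset Printing Implicit Defensive.

Import GRing.Theory.

Local Open Scope classical_set_scope.
Local Open Scope ring_scope.

(* A domain and its overrings are all viewed as subsets [A] of one field [K],
   of which they are subrings with field of fractions [K]. Ideals, integral or
   fractional, of any of these rings are then subsets of [K] as well. *)
Section Ideals.

Variable K : fieldType.

Implicit Types A I J P Q : set K.

Definition submodule A I : Prop :=
  [/\ I 0,
      forall x y, I x -> I y -> I (x + y)
    & forall a x, A a -> I x -> I (a * x)].

(* The zero ideal is integral (hence possibly prime or maximal), but it is not
   a [frac_ideal]; the latter is what "ideal" means when unqualified. *)
Definition integral_ideal A I : Prop := submodule A I /\ I `<=` A.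

Definition frac_ideal A I : Prop :=
  [/\ submodule A I,
      exists2 x, I x & x != 0
    & exists d, [/\ A d, d != 0 & forall x, I x -> A (d * x)]].

Definition prime_ideal A P : Prop :=
  [/\ integral_ideal A P, P `<` A
    & forall x y, A x -> A y -> P (x * y) -> P x \/ P y].

Definition maximal_ideal A P : Prop :=
  [/\ integral_ideal A P, P `<` A
    & forall Q, integral_ideal A Q -> Q `<` A -> P `<=` Q -> Q = P].

Definition local_with A P : Prop :=
  maximal_ideal A P /\ forall Q, maximal_ideal A Q -> Q = P.

(* [c 0 < c 1 < ... < c n] is a chain of length [n]; values of [c] beyond [n]
   are irrelevant. *)
Definition prime_chain A (n : nat) (c : nat -> set K) : Prop :=
  (forall i, (i <= n)%N -> prime_ideal A (c i)) /\
  (forall i, (i < n)%N -> c i `<` c i.+1).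

Definition has_krull_dim A (n : nat) : Prop :=
  (exists c, prime_chain A n c) /\
  (forall m c, prime_chain A m c -> (m <= n)%N).

Definition colon J I : set K := [set x | forall y, I y -> J (x * y)].

Definition ideal_mul I J : set K :=
  [set z | exists (n : nat) (x y : 'I_n -> K),
    [/\ forall i, I (x i), forall i, J (y i) & z = \sum_(i < n) x i * y i]].

Definition endo_ring I : set K := colon I I.

Definition invertible A I : Prop :=
  frac_ideal A I /\ exists2 J, frac_ideal A J & ideal_mul I J = A.

Definition principal A I : Prop :=
  frac_ideal A I /\ exists x, I = [set x * a | a in A].

Definition stable_ideal I : Prop := invertible (endo_ring I) I.

Definition strongly_stable_ideal I : Prop := principal (endo_ring I) I.

Definition stable A : Prop := forall I, frac_ideal A I -> stable_ideal I.

Definition strongly_stable A : Prop :=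
  forall I, frac_ideal A I -> strongly_stable_ideal I.

Definition clifford_regular A : Prop :=
  forall I, frac_ideal A I ->
    exists2 J, frac_ideal A J & I = ideal_mul (ideal_mul I I) J.

Definition v_closure A I : set K := colon A (colon A I).

Definition divisorial A I : Prop := I = v_closure A I.

Definition fin_gen A J : Prop :=
  exists (n : nat) (g : 'I_n -> K),
    J = [set z | exists2 a : 'I_n -> K,
                   forall i, A (a i) & z = \sum_(i < n) a i * g i].

Definition t_closure A I : set K :=
  [set x | exists J,
    [/\ frac_ideal A J, fin_gen A J, J `<=` I & v_closure A J x]].

Definition proper_t_ideal A I : Prop :=
  [/\ frac_ideal A I, I `<` A & I = t_closure A I].

Definition t_maximal A P : Prop :=
  proper_t_ideal A P /\
  forall Q, proper_t_ideal A Q -> P `<=` Q -> Q = P.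

End Ideals.

Definition domain_in_frac (R : idomainType) : set {fraction R} :=
  range (@tofrac R).

Arguments domain_in_frac R : clear implicits.

(* Main.v *)
(* Write L = I (C : I) for an ideal I with endomorphism ring C = E(I); then I is
   stable iff 1 is in L, and Clifford regularity gives I = I L. For a finitely
   generated I the determinant trick yields 1 in L, so finitely generated ideals
   are stable. Applied to ideals with at most three generators this shows that
   any overring B of R which is a fractional ideal satisfies x^2 in R + R x for
   all x in B, has at most two maximal ideals, and satisfies Jac(B)^2 <= M B.
   In particular invertible ideals of B are principal.

   If M is stable, then M = m E. An unstable ideal I has I = I N for a maximal
   ideal N of C. Choosing s outside N and in the other maximal ideal of C, one
   gets s^2 I <= I Jac(C)^2 <= M I, so that s^2 / m is an endomorphism of I E,
   hence quadratic over R; this forces s^4 into M C <= N, a contradiction. So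
   (ii) implies that every ideal is stable, and even strongly stable.

   If M is not stable, then M = M N for some maximal ideal N of E, whence
   (E : N) M <= M, that is (E : N) = E, and N is not divisorial. Conversely, if
   all ideals are stable then 1 is in N (E(N) : N), which is impossible when
   (E : N) = E. Finally, t-maximal and maximal ideals of E coincide since a
   finitely generated stable J inside E with (E : J) = E must be E. *)

Require Import Defs.
From HB Require Import structures.
From mathcomp Require Import all_boot all_algebra all_fingroup.
From mathcomp Require Import boolp classical_sets.
From mathcomp Require Import ring.

Set Implicit Arguments.
Unset Strict Implicit.
Unset Printing Implicit Defensive.

Import GRing.Theory.

Local Open Scope classical_set_scope.
Local Open Scope ring_scope.

(** * Subrings of a field and their ideals *)

Section Subrings.

Variable K : fieldType.

Implicit Types A B C E H I J L M N P Q S : set K.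

Definition subring B : Prop :=
  [/\ B 1, forall x y, B x -> B y -> B (x - y)
    & forall x y, B x -> B y -> B (x * y)].

Lemma subring1 B : subring B -> B 1. Proof. by case. Qed.

Lemma subringB B x y : subring B -> B x -> B y -> B (x - y).
Proof. by case=> _ + _; apply. Qed.

Lemma subringM B x y : subring B -> B x -> B y -> B (x * y).
Proof. by case=> _ _; apply. Qed.

Lemma subring0 B : subring B -> B 0.
Proof. by case=> B1 BB _; rewrite -(subrr 1); apply: BB. Qed.

Lemma subringN B x : subring B -> B x -> B (- x).
Proof. by move=> hB Bx; rewrite -sub0r; apply: subringB => //; apply: subring0.
Qed.

Lemma subringD B x y : subring B -> B x -> B y -> B (x + y).
Proof. by move=> hB Bx By; rewrite -(opprK y); apply: (subringB hB) => //;
  apply: subringN. Qed.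

Lemma subringX B x n : subring B -> B x -> B (x ^+ n).
Proof.
move=> hB Bx; elim: n => [|n IHn]; first exact: subring1.
by rewrite exprS; apply: subringM.
Qed.

Lemma subring_sum B n (F : 'I_n -> K) :
  subring B -> (forall i, B (F i)) -> B (\sum_(i < n) F i).
Proof.
move=> hB BF; apply: big_ind => //; first exact: subring0.
by move=> x y; apply: subringD.
Qed.

Lemma subring_submodule B : subring B -> submodule B B.
Proof.
move=> hB; split; first exact: subring0.
  by move=> x y; apply: subringD.
by move=> a x; apply: subringM.
Qed.

Lemma submodule0 B I : submodule B I -> I 0. Proof. by case. Qed.

Lemma submoduleD B I x y : submodule B I -> I x -> I y -> I (x + y).
Proof. by case=> _ + _; apply. Qed.

Lemma submoduleM B I a x : submodule B I -> B a -> I x -> I (a * x).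
Proof. by case=> _ _; apply. Qed.

Lemma submoduleMr B I a x : submodule B I -> B a -> I x -> I (x * a).
Proof. by rewrite mulrC; apply: submoduleM. Qed.

Lemma submoduleN B I x : subring B -> submodule B I -> I x -> I (- x).
Proof.
move=> hB hI Ix; rewrite -mulN1r; apply: submoduleM hI _ Ix.
by apply: subringN => //; apply: subring1.
Qed.

Lemma submoduleB B I x y :
  subring B -> submodule B I -> I x -> I y -> I (x - y).
Proof. by move=> hB hI Ix Iy; apply: (submoduleD hI) => //;
  apply: (submoduleN hB hI). Qed.

Lemma submodule_sum B I n (F : 'I_n -> K) :
  submodule B I -> (forall i, I (F i)) -> I (\sum_(i < n) F i).
Proof.
move=> hI IF; apply: big_ind => //; first exact: submodule0 hI.
by move=> x y; apply: submoduleD hI.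
Qed.

Lemma submodule_sub A B I : A `<=` B -> submodule B I -> submodule A I.
Proof. by move=> AB [I0 ID IM]; split=> // a x /AB; apply: IM. Qed.

Lemma submodule_colon A I J : submodule A J -> submodule A (colon J I).
Proof.
move=> hJ; split=> [y _|x y Jx Jy z Iz|a x Aa Jx z Iz].
- by rewrite mul0r; apply: submodule0 hJ.
- by rewrite mulrDl; apply: (submoduleD hJ); [apply: Jx|apply: Jy].
- by rewrite -mulrA; apply: (submoduleM hJ) => //; apply: Jx.
Qed.

Lemma ideal_mul_in I J x y : I x -> J y -> ideal_mul I J (x * y).
Proof.
move=> Ix Jy; exists 1%N, (fun=> x), (fun=> y); split=> //.
by rewrite big_ord1.
Qed.

Lemma ideal_mul_sub B I J H : submodule B H ->
  (forall x y, I x -> J y -> H (x * y)) -> ideal_mul I J `<=` H.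
Proof.
move=> hH HM z [n [x [y [Ix Jy ->]]]].
by apply: (submodule_sum hH) => i; apply: HM.
Qed.

Lemma submodule_ideal_mul B I J :
  submodule B I -> submodule B (ideal_mul I J).
Proof.
move=> hI; split.
- by exists 0%N, (fun=> 0), (fun=> 0); split=> [[]|[]|] //; rewrite big_ord0.
- move=> _ _ [m [x [y [Ix Jy ->]]]] [n [z [t [Iz Jt ->]]]].
  exists (m + n)%N, (fun i => match split i with inl j => x j | inr j =>
    z j end),
    (fun i => match split i with inl j => y j | inr j => t j end).
  split=> [i|i|]; try by case: split.
  rewrite big_split_ord; congr (_ + _); apply: eq_bigr => i _.
    by rewrite (unsplitK (inl i)).
  by rewrite (unsplitK (inr i)).
- move=> a _ Ba [n [x [y [Ix Jy ->]]]].
  exists n, (fun i => a * x i), y; split=> // [i|];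
    first exact: submoduleM hI _ _.
  by rewrite mulr_sumr; apply: eq_bigr => i _; rewrite mulrA.
Qed.

Lemma ideal_mulS I J H L :
  I `<=` H -> J `<=` L -> ideal_mul I J `<=` ideal_mul H L.
Proof.
by move=> IH JL z [n [x [y [Ix Jy ->]]]]; exists n, x, y; split=> // i; auto.
Qed.

Lemma subring_endo A I : submodule A I -> subring A -> subring (endo_ring I).
Proof.
move=> hI hA; split=> [x Ix|x y Ex Ey z Iz|x y Ex Ey z Iz].
- by rewrite mul1r.
- by rewrite mulrBl; apply: (submoduleB hA hI); [apply: Ex|apply: Ey].
- by rewrite -mulrA; apply/Ex/Ey.
Qed.

Lemma sub_endo A I : submodule A I -> A `<=` endo_ring I.
Proof. by move=> hI a Aa x Ix; apply: submoduleM hI _ _. Qed.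

Lemma endo_submodule A I : submodule A I -> submodule (endo_ring I) I.
Proof.
move=> hI; split; first exact: submodule0 hI.
  by move=> x y; apply: submoduleD hI.
by move=> a x; apply.
Qed.

Lemma submodule_preim A I c :
  submodule A I -> submodule A [set z | I (c * z)].
Proof.
move=> hI; split=> [|y z Iy Iz|a y Aa Iy] /=.
- by rewrite mulr0; apply: submodule0 hI.
- by rewrite mulrDr; apply: submoduleD hI _ _.
- by rewrite mulrCA; apply: submoduleM hI _ _.
Qed.

(** This is the sum [I] + [B] x. *)
Definition adjoin B I x : set K := [set z | exists2 b, B b & I (z - b * x)].

Lemma submodule_adjoin B I x :
  subring B -> submodule B I -> submodule B (adjoin B I x).
Proof.
move=> hB hI; split.
- by exists 0; [exact: subring0|rewrite mul0r subr0; apply: submodule0 hI].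
- move=> y z [b Bb Iy] [c Bc Iz]; exists (b + c); first exact: subringD.
  by have := submoduleD hI Iy Iz; congr (I _); ring.
- move=> a y Ba [b Bb Iy]; exists (a * b); first exact: subringM.
  by have := submoduleM hI Ba Iy; congr (I _); ring.
Qed.

Lemma adjoin_in B I x : subring B -> submodule B I -> adjoin B I x x.
Proof.
move=> hB hI; exists 1; first exact: subring1.
by rewrite mul1r subrr; apply: submodule0 hI.
Qed.

Lemma sub_adjoin B I x : subring B -> I `<=` adjoin B I x.
Proof.
by move=> hB y Iy; exists 0; [exact: subring0|rewrite mul0r subr0].
Qed.

Lemma adjoin_sub B I H x :
  submodule B H -> I `<=` H -> H x -> adjoin B I x `<=` H.
Proof.
move=> hH IH Hx y [b Bb /IH Iy]; rewrite -(subrK (b * x) y).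
by apply: (submoduleD hH) => //; apply: submoduleM hH _ _.
Qed.

Lemma fin_gen0 B : fin_gen B [set 0].
Proof.
exists 0%N, (fun=> 0); apply/seteqP; split=> z /=.
  by move=> ->; exists (fun=> 0) => [[]|] //; rewrite big_ord0.
by move=> [a _ ->]; rewrite big_ord0.
Qed.

Lemma fin_gen_adjoin B I x : fin_gen B I -> fin_gen B (adjoin B I x).
Proof.
move=> [n [g ->]].
exists n.+1, (fun i => if unlift ord0 i is Some j then g j else x).
apply/seteqP; split=> z /=.
  move=> [b Bb [a Ba zE]].
  exists (fun i => if unlift ord0 i is Some j then a j else b) => [i|].
    by case: unlift.
  rewrite big_ord_recl unlift_none -[LHS](subrK (b * x)) zE addrC.
  by congr (_ + _); apply: eq_bigr => i _; rewrite liftK.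
move=> [a Ba ->]; exists (a ord0) => //; exists (a \o lift ord0) => [i|] /=.
  exact: Ba.
rewrite big_ord_recl unlift_none addrC addKr.
by apply: eq_bigr => i _; rewrite liftK.
Qed.

(** * Zorn's lemma and maximal ideals *)

Lemma zorn_ideal B S I : subring B -> integral_ideal B I ->
    (forall x, S x -> ~ I x) ->
  exists P, [/\ integral_ideal B P, I `<=` P, forall x, S x -> ~ P x
    & forall Q, integral_ideal B Q -> P `<=` Q -> (forall x, S x -> ~ Q x) ->
      Q = P].
Proof.
move=> hB hI SI.
pose G X := [/\ integral_ideal B X, I `<=` X & forall x, S x -> ~ X x].
have [F FG Ftot|P [GP maxP]] := @Zorn_bigcup K (fun X => X = set0 \/ G X).
- have [[X0 [FX0 GX0]]|noG] := EM (exists X, F X /\ G X); last first.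
    left; apply/seteqP; split=> // x [X FX Xx].
    have [X0|GX] := FG _ FX; first by rewrite X0 in Xx.
    by case: noG; exists X.
  have Gx X x : F X -> X x -> G X.
    by move=> FX Xx; have [X00|//] := FG _ FX; rewrite X00 in Xx.
  right; split; last 1 first.
  + by move=> x Sx [X FX Xx]; have [_ _ /(_ x Sx)] := Gx _ _ FX Xx.
  + split; last first.
      by move=> x [X FX Xx]; have [[_ XB] _ _] := Gx _ _ FX Xx; apply: XB.
    split.
    * by have [[hX _] _ _] := GX0; exists X0 => //; apply: submodule0 hX.
    * move=> x y [X FX Xx] [Y FY Yy]; have [XY|YX] := Ftot _ _ FX FY.
        have [[hY _] _ _] := Gx _ _ FY Yy; exists Y => //.
        by apply: submoduleD hY _ _ => //; apply: XY.
      have [[hX _] _ _] := Gx _ _ FX Xx; exists X => //.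
      by apply: submoduleD hX _ _ => //; apply: YX.
    * move=> a x Ba [X FX Xx]; have [[hX _] _ _] := Gx _ _ FX Xx.
      by exists X => //; apply: submoduleM hX _ _.
  + by move=> x Ix; exists X0 => //; have [_ + _] := GX0; apply.
- have GP' : G P.
    case: GP => // P0; exfalso; apply: (maxP I); last by right; split.
    rewrite P0; split=> // /(_ 0); apply.
    by have [hI' _] := hI; apply: submodule0 hI'.
  have [hP IP SP] := GP'; exists P; split=> // Q hQ PQ SQ.
  apply: contrapT => QP; apply: (maxP Q).
    by split=> // QP'; apply: QP; apply/seteqP.
  by right; split=> //; apply: subset_trans PQ.
Qed.

Lemma maximal_ideal_above B I : subring B -> integral_ideal B I -> ~ I 1 ->
  exists2 N, maximal_ideal B N & I `<=` N.
Proof.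
move=> hB hI I1.
have [_ ->//|N [hN IN N1 maxN]] := @zorn_ideal B [set 1] I hB hI.
exists N => //; split=> //; first by have [_ NB] := hN;
  split=> // /(_ 1 (subring1 hB)); apply: (N1 1).
move=> Q hQ [QB BQ] NQ; apply: maxN => // _ -> Q1; apply: BQ => x Bx.
by have [hQ' _] := hQ; rewrite -(mulr1 x); apply: submoduleM hQ' _ _.
Qed.

Section Maximal.

Variables (B N : set K).
Hypotheses (hB : subring B) (hN : maximal_ideal B N).

Lemma maximal_submodule : submodule B N. Proof. by case: hN => -[]. Qed.

Lemma maximal_sub : N `<=` B. Proof. by case: hN => -[]. Qed.

Lemma maximal_1 : ~ N 1.
Proof.
have [_ [_ BN] _] := hN => N1; apply: BN => x Bx; rewrite -(mulr1 x).
exact: submoduleM maximal_submodule _ _.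
Qed.

(** By maximality [N] + [B] x is all of [B], so it contains 1. *)
Lemma maximal_comax x : B x -> ~ N x -> exists2 b, B b & N (1 - b * x).
Proof.
move=> Bx Nx; have hNm := maximal_submodule.
have [hI [_ _] maxN] := hN.
have hQ : integral_ideal B (adjoin B N x).
  split; first exact: submodule_adjoin.
  move=> y [b Bb Ny]; rewrite -(subrK (b * x) y).
  by apply: subringD => //; [apply: maximal_sub|apply: subringM].
apply: contrapT => nb; apply: Nx.
rewrite -(maxN _ hQ).
- exact: adjoin_in.
- split; first by case: hQ.
  by move=> /(_ 1 (subring1 hB)).
- exact: sub_adjoin.
Qed.

Lemma maximal_prime x y : B x -> B y -> N (x * y) -> N x \/ N y.
Proof.
move=> Bx By Nxy; have [|nNx] := EM (N x); [by left|right].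
have [b Bb Nb] := maximal_comax Bx nNx; have hNm := maximal_submodule.
have -> : y = (1 - b * x) * y + b * (x * y) by ring.
apply: (submoduleD hNm); first exact: submoduleMr hNm _ _.
exact: submoduleM hNm _ _.
Qed.

Lemma maximal_unit x : B x^-1 -> x != 0 -> ~ N x.
Proof.
move=> Bx x0 Nx; apply: maximal_1; rewrite -(mulVf x0).
exact: submoduleM maximal_submodule _ _.
Qed.

Lemma maximal_comax2 N' : maximal_ideal B N' -> N' <> N ->
  exists x, [/\ B x, N' x & N (1 - x)].
Proof.
move=> hN' neqN.
have [y N'y nNy] : exists2 y, N' y & ~ N y.
  apply: contrapT => noy; apply: neqN; have [_ _ maxN'] := hN'.
  apply/esym/maxN'; [by case: hN|by case: hN|move=> y N'y].
  by apply: contrapT => nNy; apply: noy; exists y.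
have [hN'B N'B] : integral_ideal B N' by case: hN'.
have [b Bb Nb] := maximal_comax (N'B _ N'y) nNy.
exists (b * y); split=> //; first by apply: (subringM hB) => //; apply: N'B.
exact: submoduleM hN'B _ _.
Qed.

End Maximal.

Lemma unit_of_no_maximal B x : subring B -> B x -> x != 0 ->
  (forall N, maximal_ideal B N -> ~ N x) -> B x^-1.
Proof.
move=> hB Bx x0 noN; apply: contrapT => Bxi.
have hI : integral_ideal B [set b * x | b in B].
  split.
    split.
    - by exists 0; rewrite ?mul0r//; apply: subring0.
    - move=> _ _ [b Bb <-] [c Bc <-]; exists (b + c); first exact: subringD.
      by rewrite mulrDl.
    - move=> a _ Ba [b Bb <-]; exists (a * b); first exact: subringM.
      by rewrite mulrA.
  by move=> _ [b Bb <-]; apply: subringM.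
have [|N hN IN] := maximal_ideal_above hB hI.
  by move=> [b Bb bx]; apply: Bxi; rewrite -(mulfK x0 b) bx div1r in Bb *.
apply: (noN N hN); apply: IN; exists 1; rewrite ?mul1r//; exact: subring1.
Qed.

(* [1 - \det (1%:M - X)] lies in the ideal [L] when the entries of [X] do. *)
Lemma det_trick C L n (g : 'I_n -> K) : subring C -> integral_ideal C L ->
    (exists i, g i != 0) ->
    (forall i, exists2 l : 'I_n -> K, forall j, L (l j) &
                 g i = \sum_(j < n) l j * g j) ->
  L 1.
Proof.
move=> hC [hL LC] [i0 gi0] gL.
have /choice[X XP] i : exists l : 'I_n -> K,
    (forall j, L (l j)) /\ g i = \sum_(j < n) l j * g j.
  by have [l] := gL i; exists l.
(* [D] kills the nonzero column of the g i, so its determinant vanishes. *)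
pose D := 1%:M - \matrix_(i, j) X i j : 'M[K]_n.
have detD : \det D = 0.
  apply/eqP/negPn/negP => detD.
  have Du : D \in unitmx by rewrite unitmxE unitfE.
  have Dg : D *m (\col_i g i) = 0.
    apply/matrixP => i j; rewrite mulmxBl mul1mx !mxE (XP i).2 -sumrB.
    rewrite big1// => k _; rewrite !mxE; ring.
  have : \col_i g i = 0 by rewrite -(mulKmx Du (\col_i g i)) Dg mulmx0.
  by move=> /matrixP/(_ i0 0); rewrite !mxE => /eqP; rewrite (negPf gi0).
have DC i j : C (D i j).
  rewrite !mxE; apply: subringB => //; last exact/LC/(XP i).1.
  by case: eqP => _; [apply: subring1|apply: subring0].
have -> : 1 = 1 - \det D by rewrite detD subr0.
rewrite /determinant (bigD1 1%g)//= odd_perm1 mul1r opprD addrA.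
apply: (submoduleB hC hL).
  (* The identity permutation contributes a product of diagonal entries, each congruent to 1 modulo
     [L]. *)
  pose s1 : {perm 'I_n} := 1%g.
  suff [] : L (1 - \prod_i D i (s1 i)) /\ C (\prod_i D i (s1 i)) by [].
  apply: (big_ind (fun z => L (1 - z) /\ C z)) => [|x y [Lx Cx] [Ly Cy]|i _].
  - by rewrite subrr; split; [apply: submodule0 hL|apply: subring1].
  - split; last exact: subringM.
    have -> : 1 - x * y = (1 - x) + x * (1 - y) by ring.
    by apply: (submoduleD hL) => //; apply: submoduleM hL _ _.
  - split=> //; rewrite perm1 !mxE eqxx/= mulr1n opprB addrC subrK.
    exact: (XP i).1.
apply: big_ind => [|x y|s s1]; first exact: submodule0 hL.
  exact: submoduleD hL.
(* Any other permutation moves some i, and picks there an off-diagonal entry, which lies in [L]. *)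
have [i si] : exists i, s i != i.
  apply: contrapT => ns; move/eqP: s1; apply; apply/permP => i; rewrite perm1.
  by apply/eqP/negPn/negP => si; apply: ns; exists i.
apply: (submoduleM hL); first by apply: (subringX _ hC); apply: (subringN hC);
  apply: subring1.
rewrite (bigD1 i)//=; apply: (submoduleMr hL).
  by apply: big_ind => // [|x y]; [exact: subring1|exact: subringM].
rewrite !mxE eq_sym (negPf si) mulr0n sub0r; apply: (submoduleN hC hL).
exact: (XP i).1.
Qed.

End Subrings.

(** * Fractional ideals of Clifford regular domains *)

Section FractionalIdeals.

Variables (K : fieldType) (A : set K).
Hypothesis hA : subring A.

Implicit Types B I J : set K.

Definition frac_overring B : Prop :=
  [/\ subring B, A `<=` B
    & exists d, [/\ A d, d != 0 & forall x, B x -> A (d * x)]].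

(** The trace of the module [I] over its endomorphism ring. *)
Definition trace_ideal I : set K := ideal_mul I (colon (endo_ring I) I).

(** Explicit coefficients let [ring] settle the computations; a zero generator gives the case of
    two. *)
Definition gen3 (x y z : K) : set K :=
  [set t | exists a b c, [/\ A a, A b, A c & t = a * x + b * y + c * z]].

Lemma endo_overring I : frac_ideal A I -> frac_overring (endo_ring I).
Proof.
move=> [hI [x Ix x0] [d [Ad d0 dI]]]; split;
  [exact: subring_endo hI hA|exact: sub_endo|].
exists (d * x); split; [exact: dI|by rewrite mulf_neq0|].
by move=> c Ec; rewrite mulrAC -mulrA; apply: dI; apply: Ec.
Qed.

Lemma frac_endo I : frac_ideal A I -> frac_ideal (endo_ring I) I.
Proof.
move=> [hI Inz [d [Ad d0 dI]]]; split=> //; first exact: endo_submodule hI.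
exists d; split=> // [|x Ix]; first exact: sub_endo hI _ Ad.
exact: sub_endo hI _ (dI _ Ix).
Qed.

Lemma frac_descend B I : frac_overring B -> frac_ideal B I -> frac_ideal A I.
Proof.
move=> [hB AB [d [Ad d0 dB]]] [hI Inz [e [Be e0 eI]]].
split=> //; first exact: submodule_sub hI.
(* The denominator has to lie in [A]: d e does because e is in [B], and the other d brings e x from
   [B] into [A]. *)
exists (d * (d * e)); split; last 1 first.
- by move=> x Ix; rewrite -!mulrA; apply: (subringM hA) => //; apply/dB/eI.
- by apply: (subringM hA) => //; apply: dB.
- by rewrite !mulf_neq0.
Qed.

Lemma frac_sub B I : frac_overring B -> submodule A I -> I `<=` B ->
  (exists2 x, I x & x != 0) -> frac_ideal A I.
Proof.
move=> [hB AB [d [Ad d0 dB]]] hI IB Inz; split=> //.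
by exists d; split=> // x /IB /dB.
Qed.

Lemma frac_colon I :
  frac_ideal A I -> frac_ideal (endo_ring I) (colon (endo_ring I) I).
Proof.
move=> fI; have [hC AC _] := endo_overring fI.
have [hI [x Ix x0] [d [Ad d0 dI]]] := fI; split.
- exact/submodule_colon/subring_submodule.
- by exists d => // y Iy; apply/AC/dI.
- exists (d * x); split; [exact/AC/dI|by rewrite mulf_neq0|].
  move=> y Jy; rewrite -mulrA; apply: (subringM hC); first exact: AC.
  by rewrite mulrC; apply: Jy.
Qed.

Lemma frac_mul I B : frac_ideal A I -> frac_overring B ->
  frac_ideal A (ideal_mul I B).
Proof.
move=> [hI [x Ix x0] [d [Ad d0 dI]]] [hB AB [e [Ae e0 eB]]]; split.
- exact: submodule_ideal_mul.
- exists x => //; rewrite -(mulr1 x); apply: ideal_mul_in => //.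
  exact: subring1.
- exists (d * e); split; [exact: subringM|by rewrite mulf_neq0|].
  apply: (ideal_mul_sub (submodule_preim _ (subring_submodule hA))).
  by move=> y z Iy Bz /=; rewrite mulrACA; apply: (subringM hA); auto.
Qed.

Lemma trace_integral I :
  frac_ideal A I -> integral_ideal (endo_ring I) (trace_ideal I).
Proof.
move=> fI; have [hC _ _] := endo_overring fI; have [hI _ _] := frac_endo fI.
split; first exact: submodule_ideal_mul.
apply: ideal_mul_sub (subring_submodule hC) _ => x y Ix Jy.
by rewrite mulrC; apply: Jy.
Qed.

(** Any inverse of [I] lies in (E(I) : I), so the trace ideal contains E(I) as soon as some product
    does; conversely it is an ideal of E(I), hence all of it once it contains 1. *)
Lemma stable_idealE I : frac_ideal A I -> stable_ideal I <-> trace_ideal I 1.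
Proof.
move=> fI; have [hC _ _] := endo_overring fI; split=> [[_ [J _ IJ]]|t1].
  apply: (ideal_mulS (I := I) (J := J)) => //; last first.
    by rewrite IJ; apply: subring1.
  by move=> y Jy x Ix; rewrite -IJ mulrC; apply: ideal_mul_in.
split; first exact: frac_endo.
exists (colon (endo_ring I) I); first exact: frac_colon.
have [hT TC] := trace_integral fI.
apply/seteqP; split=> // x Cx; rewrite -(mulr1 x).
exact: submoduleM hT _ _.
Qed.

Lemma trace_stable_absorb I : trace_ideal I 1 -> submodule A I ->
  I `<=` ideal_mul (ideal_mul I I) (colon (endo_ring I) I).
Proof.
move=> [n [x [y [Ix Jy e1]]]] hI t It; rewrite -(mulr1 t) e1 mulr_sumr.
exists n, (fun i => t * x i), y; split=> // [i|]; first exact: ideal_mul_in.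
by apply: eq_bigr => i _; rewrite mulrA.
Qed.

(** Stability makes [I] equal to its product with its trace ideal, so (E(I) : I) serves as the
    second factor. *)
Lemma clifford_of_stable : stable A -> clifford_regular A.
Proof.
move=> sA I fI; exists (colon (endo_ring I) I).
  exact: frac_descend (endo_overring fI) (frac_colon fI).
have [hI _ _] := fI; apply/seteqP; split.
  by apply: trace_stable_absorb => //; apply/stable_idealE/sA.
have hIE := endo_submodule hI.
apply: (ideal_mul_sub hIE) => x y IIx Jy; rewrite mulrC; move: x IIx.
apply: (ideal_mul_sub (submodule_preim y hI)) => x z Ix Iz /=.
by rewrite mulrA; apply: (submoduleM hIE) => //; apply: Jy.
Qed.

(** * Consequences of Clifford regularity *)

Hypothesis cA : clifford_regular A.

(** If I = I I J, then J I maps I into itself, so J lies in (E(I) : I) and I J in the trace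
    ideal. *)
Lemma clifford_trace I : frac_ideal A I -> I `<=` ideal_mul I (trace_ideal I).
Proof.
move=> fI; have [hI _ _] := fI; have [J [hJ _ _] IJ] := cA fI.
have hIE := endo_submodule hI.
have JC y : J y -> colon (endo_ring I) I y.
  move=> Jy x Ix z Iz; have -> : y * x * z = x * z * y by ring.
  by rewrite IJ; do 2 apply: ideal_mul_in => //.
have hII : submodule A (ideal_mul I (trace_ideal I)).
  exact: submodule_ideal_mul.
rewrite {1}IJ; apply: (ideal_mul_sub hII) => x y IIx Jy; rewrite mulrC.
move: x IIx; apply: (ideal_mul_sub (submodule_preim y hII)) => x z Ix Iz /=.
rewrite mulrCA; apply: ideal_mul_in => //; rewrite mulrC.
by apply: ideal_mul_in => //; apply: JC.
Qed.

(** Each generator lies in [I] times the trace ideal, hence is a combination of the generators with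
    coefficients in the trace ideal, and [det_trick] applies. *)
Lemma fin_gen_stable B I : frac_overring B -> frac_ideal B I -> fin_gen B I ->
  trace_ideal I 1.
Proof.
move=> oB fBI [n [g gI]]; have fI := frac_descend oB fBI.
have [hB _ _] := oB; have [hBI [x Ix x0] _] := fBI.
have [hT TC] := trace_integral fI; have [hC _ _] := endo_overring fI.
have Ig i : I (g i).
  rewrite gI; exists (fun j => (j == i)%:R) => [j|].
    by case: eqP => _; [apply: subring1|apply: subring0].
  rewrite (bigD1 i)//= eqxx mul1r big1 ?addr0// => j /negPf ->.
  by rewrite mul0r.
apply: (det_trick (C := endo_ring I) (g := g)) => //.
  apply: contrapT => g0; move/eqP: x0; apply.
  move: Ix; rewrite gI => -[a _ ->]; apply: big1 => i _.
  have /eqP -> : g i == 0; last by rewrite mulr0.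
  by apply/negPn/negP => gi; apply: g0; exists i.
move=> i; have := clifford_trace fI (Ig i); move: (g i).
suff : ideal_mul I (trace_ideal I) `<=` [set z | exists2 l : 'I_n -> K,
    forall j, trace_ideal I (l j) & z = \sum_(j < n) l j * g j] by [].
apply: (@ideal_mul_sub _ (endo_ring I)).
  split=> [|_ _ [a Ta ->] [b Tb ->]|c _ Cc [a Ta ->]].
  - exists (fun=> 0) => [j|]; first exact: submodule0 hT.
    by rewrite big1// => j _; rewrite mul0r.
  - exists (fun j => a j + b j) => [j|]; first exact: submoduleD hT _ _.
    by rewrite -big_split; apply: eq_bigr => j _; rewrite mulrDl.
  - exists (fun j => c * a j) => [j|]; first exact: submoduleM hT _ _.
    by rewrite mulr_sumr; apply: eq_bigr => j _; rewrite mulrA.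
move=> y t; rewrite {1}gI => -[a Ba ->] Tt.
exists (fun j => a j * t) => [j|].
  by apply: (submoduleM hT) => //; apply: (sub_endo hBI).
by rewrite mulr_suml; apply: eq_bigr => j _; rewrite mulrAC.
Qed.

Lemma submodule_gen3 x y z : submodule A (gen3 x y z).
Proof.
split=> [|_ _ [a [b [c [Aa Ab Ac ->]]]] [a' [b' [c' [Aa' Ab' Ac' ->]]]]|
  e _ Ae [a [b [c [Aa Ab Ac ->]]]]].
- by exists 0, 0, 0; split; rewrite ?mul0r ?addr0 //; apply: subring0.
- exists (a + a'), (b + b'), (c + c'); split; rewrite ?mulrDl;
  try exact: subringD.
  ring.
- exists (e * a), (e * b), (e * c); split; try exact: subringM.
  ring.
Qed.

(** The membership of 1 in the trace ideal, with its terms collected along the three generators. *)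
Lemma gen3_stable B x y z :
    frac_overring B -> B x -> B y -> B z -> x != 0 ->
  let I := gen3 x y z in
  [/\ frac_ideal A I, I x, I y, I z & exists p q r,
    [/\ colon (endo_ring I) I p, colon (endo_ring I) I q,
        colon (endo_ring I) I r & 1 = p * x + q * y + r * z]].
Proof.
move=> oB Bx By Bz x0 I; have [hB AB _] := oB.
have A0 := subring0 hA; have A1 := subring1 hA.
have Ix : I x by exists 1, 0, 0; split=> //; ring.
have Iy : I y by exists 0, 1, 0; split=> //; ring.
have Iz : I z by exists 0, 0, 1; split=> //; ring.
have hI : submodule A I := @submodule_gen3 x y z.
have fI : frac_ideal A I.
  apply: frac_sub oB hI _ _; last by exists x.
  move=> _ [a [b [c [/AB Ba /AB Bb /AB Bc ->]]]].
  by do 2?apply: (subringD hB) => //; apply: (subringM hB).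
split=> //.
have oA : frac_overring A by split=> //; exists 1; split;
  rewrite ?oner_neq0// => t; rewrite mul1r.
have fgI : fin_gen A I.
  exists 3%N, (fun i => [:: x; y; z]`_i); apply/seteqP; split=> t /=.
    move=> [a [b [c [Aa Ab Ac ->]]]]; exists (fun i => [:: a; b; c]`_i).
      by case=> -[|[|[|]]].
    by rewrite !big_ord_recl big_ord0 addr0 addrA.
  move=> [a Aa ->]; exists (a ord0), (a (lift ord0 ord0)),
    (a (lift ord0 (lift ord0 ord0))).
  by split=> //; rewrite !big_ord_recl big_ord0 addr0 addrA.
have [hC AC _] := endo_overring fI.
have hJ := submodule_colon I (subring_submodule hC).
have [p [q [r [Jp Jq Jr ->]]]] : [set t | exists p q r,
    [/\ colon (endo_ring I) I p, colon (endo_ring I) I q,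
        colon (endo_ring I) I r & t = p * x + q * y + r * z]] 1; last first.
  by exists p, q, r.
move: (fin_gen_stable oA fI fgI); apply: (@ideal_mul_sub _ (endo_ring I)).
  split=> [|_ _ [p [q [r [Jp Jq Jr ->]]]] [p' [q' [r' [Jp' Jq' Jr' ->]]]]|
    e _ Ae [p [q [r [Jp Jq Jr ->]]]]].
  - by exists 0, 0, 0; split; rewrite ?mul0r ?addr0 //; apply: submodule0 hJ.
  - exists (p + p'), (q + q'), (r + r'); split; rewrite ?mulrDl;
    try exact: (submoduleD hJ).
    ring.
  - by exists (e * p), (e * q), (e * r); split;
    try exact: (submoduleM hJ Ae _); ring.
move=> _ t [a [b [c [/AC Ca /AC Cb /AC Cc ->]]]] Jt.
by exists (a * t), (b * t), (c * t); split; try exact: submoduleM hJ _ _; ring.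
Qed.

End FractionalIdeals.

(** * One-dimensional local domains *)

Lemma exists_maximal (K : fieldType) (B : set K) :
  subring B -> exists N, maximal_ideal B N.
Proof.
move=> hB; have [|/= /eqP|N] := @maximal_ideal_above K B [set 0] hB.
- split=> [|_ ->]; last exact: subring0.
  by split=> [//|_ _ -> ->|a _ _ ->]; rewrite ?addr0 ?mulr0.
- by rewrite oner_eq0.
- by exists N.
Qed.

(** The v-closure of [N] lies between [N] and [B], so by maximality it is [N] unless it contains 1,
    and that means (B : N) lies in [B]. *)
Lemma divisorial_maximal (K : fieldType) (B N : set K) : subring B ->
  maximal_ideal B N -> divisorial B N <-> ~ (colon B N `<=` B).
Proof.
move=> hB hN; have sN := maximal_submodule hN; have NB := maximal_sub hN.
split=> [dN NvB|nv].
  apply: (maximal_1 hN); rewrite dN => y Jy; rewrite mul1r; exact: NvB.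
have [_ _ maxN] := hN.
have hv : submodule B (v_closure B N).
  exact/submodule_colon/subring_submodule.
have vB : v_closure B N `<=` B.
  move=> x vx; rewrite -(mulr1 x); apply: vx => y Ny; rewrite mul1r; exact: NB.
apply/esym/maxN => //; last by move=> x Nx y Jy; rewrite mulrC; apply: Jy.
split=> // /(_ 1 (subring1 hB)) v1; apply: nv => y Jy.
by rewrite -(mul1r y); apply: v1.
Qed.

(** For y in (E(I) : I) and z, t in [I], y z t lies in [I], hence in [B]; using (B : I) inside [B]
    twice gives first y z, then y, in [B]. So the trace ideal lies in [I]. *)
Lemma trace_colon_sub (K : fieldType) (B I : set K) :
  subring B -> submodule B I -> I `<=` B -> trace_ideal I 1 ->
  colon B I `<=` B -> I 1.
Proof.
move=> hB hI IB tI JB; move: tI; apply: (ideal_mul_sub hI) => x y Ix Jy.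
apply: (submoduleMr hI) => //; apply: (JB) => z Iz; apply: (JB) => t It.
by apply: IB; apply: Jy.
Qed.

(* [Arad], by which [M] is the radical of every nonzero principal ideal, is the
   only form in which one-dimensionality is used. *)
Section LocalOneDim.

Variables (K : fieldType) (A M : set K).
Hypothesis hA : subring A.
Hypothesis hM : integral_ideal A M.
Hypothesis M1 : ~ M 1.
Hypothesis Mneq0 : exists2 m, M m & m != 0.
Hypothesis Aunit : forall a, A a -> ~ M a -> A a^-1.
Hypothesis Arad : forall b d, M b -> A d -> d != 0 ->
  exists n, exists2 a, A a & b ^+ n = d * a.
Hypothesis cA : clifford_regular A.

Implicit Types B I J N : set K.

Let hMA : submodule A M. Proof. by case: hM. Qed.
Let MA : M `<=` A. Proof. by case: hM. Qed.

Let Mneq a : ~ M a -> a != 0.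
Proof. by move=> nMa; apply/eqP => a0; apply: nMa; rewrite a0;
  apply: submodule0 hMA. Qed.

Lemma nonunit_prime a b : A a -> ~ M a -> M (a * b) -> M b.
Proof.
move=> Aa nMa Mab; have a0 := Mneq nMa.
rewrite -(mulKf a0 b); apply: (submoduleM hMA) => //; exact: Aunit.
Qed.

Lemma local_pow a n : A a -> ~ M a -> ~ M (a ^+ n).
Proof.
move=> Aa nMa; elim: n => [|n IHn]; first by rewrite expr0.
by rewrite exprS => /(nonunit_prime Aa nMa).
Qed.

Lemma local_1B a : M a -> ~ M (1 - a).
Proof. by move=> Ma M1a; apply: M1; rewrite -(subrK a 1);
  apply: submoduleD hMA _ _. Qed.

(** Some d clears the denominators of all of [B], and a power of b is a multiple of d; one further
    factor b lands in [M]. *)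
Lemma overring_pow B b x : frac_overring A B -> M b -> B x ->
  exists n, M ((b * x) ^+ n).
Proof.
move=> [hB AB [d [Ad d0 dB]]] Mb Bx.
have [n [a Aa bn]] := Arad Mb Ad d0; exists n.+1.
have -> : (b * x) ^+ n.+1 = (a * (d * x ^+ n.+1)) * b.
  rewrite exprMn [b ^+ _]exprS bn; ring.
apply: (submoduleM hMA) => //; apply: (subringM hA) => //.
by apply: dB; apply: subringX.
Qed.

(** The difference a^n - (-w)^n has the factor a + w, and it is a unit of [A] because it equals a^n
    modulo [M]. *)
Lemma unit_add_nilp B a w n : subring B -> A `<=` B -> A a -> ~ M a -> B w ->
  M (w ^+ n) -> B (a + w)^-1 /\ a + w != 0.
Proof.
move=> hB AB Aa nMa Bw Mwn.
pose v := a ^+ n - (- w) ^+ n.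
have Mw : M ((- w) ^+ n).
  rewrite exprNn; apply: (submoduleM hMA) => //.
  by apply: (subringX _ hA); apply: (subringN hA); apply: subring1.
have Av : A v by apply: (subringB hA); [apply: subringX|apply: MA].
have nMv : ~ M v.
  move=> Mv; apply: (local_pow (n := n) Aa nMa).
  by rewrite -(subrK ((- w) ^+ n) (a ^+ n)); apply: submoduleD hMA _ _.
have v0 := Mneq nMv.
pose S := \sum_(i < n) a ^+ (n.-1 - i) * (- w) ^+ i.
have vE : v = (a + w) * S by rewrite /v subrXX opprK.
have aw0 : a + w != 0 by apply: contra_neq v0; rewrite vE => ->; rewrite mul0r.
split=> //; have -> : (a + w)^-1 = S * v^-1.
  by apply: (mulfI aw0); rewrite mulfV// mulrA -vE mulfV.
apply: (subringM hB); last exact/AB/Aunit.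
apply: (subring_sum hB) => i; apply: (subringM hB); apply: (subringX _ hB).
  exact: AB.
exact: subringN.
Qed.

(* Stability of [A + A x] yields [1 = p + q x] with [p] and [q] in
   [(C : A + A x)], where [C] is its endomorphism ring; either [p] is a unit of
   [C] or [q x] is, and both force [x] into [C]. *)
Lemma overring_quadratic B x : frac_overring A B -> B x ->
  exists a b, [/\ A a, A b & x * x = a + b * x].
Proof.
move=> oB Bx; have [hB AB _] := oB.
have A1 := subring1 hA; have B1 := subring1 hB; have B0 := subring0 hB.
have [->|x0] := eqVneq x 0.
  by exists 0, 0; split; [exact: subring0|exact: subring0|ring].
have := gen3_stable hA cA oB B1 Bx B0 (oner_neq0 K).
set I := gen3 A 1 x 0; move=> /= [fI I1 Ix _ [p [q [r [Jp Jq _ pq]]]]].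
have IE t : I t -> exists a b, [/\ A a, A b & t = a + b * x].
  by move=> [a [b [c [Aa Ab _ ->]]]]; exists a, b; split=> //; ring.
have oC := endo_overring hA fI; move: Jp Jq oC; set C := endo_ring I.
move=> Jp Jq oC; have [hC AC _] := oC.
have CI c : C c -> I c by move=> /(_ 1 I1); rewrite mulr1.
have IB t : I t -> B t.
  move=> /IE[a [b [/AB Ba /AB Bb ->]]].
  by apply: (subringD hB) => //; apply: subringM.
suff Cx : C x by have [a [b]] := IE _ (Cx x Ix); exists a, b.
apply: contrapT => nCx.
(* If b were a unit of [A], then c - a = b x would put x into [C]. *)
have CE c : C c -> exists a b, [/\ A a, M b & c = a + b * x].
  move=> Cc; have [a [b [Aa Ab cE]]] := IE _ (CI _ Cc).
  exists a, b; split=> //; apply: contrapT => nMb; apply: nCx.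
  have -> : x = b^-1 * (c - a) by rewrite cE addrAC subrr add0r mulKf ?Mneq.
  apply: (subringM hC); first exact/AC/Aunit.
  by apply: (subringB hC) => //; apply: AC.
have Cunit a b : A a -> ~ M a -> M b -> C (a + b * x) ->
    C (a + b * x)^-1 /\ a + b * x != 0.
  move=> Aa nMa Mb Cab; have [n Mn] := overring_pow oB Mb Bx.
  apply: (unit_add_nilp hC AC Aa nMa _ Mn).
  have -> : b * x = a + b * x - a by ring.
  by apply: (subringB hC) => //; apply: AC.
have Cp : C p by rewrite -(mulr1 p); apply: Jp.
have Cq : C q by rewrite -(mulr1 q); apply: Jq.
have [a [b [Aa Mb pE]]] := CE _ Cp.
(* If a is a unit, p is invertible in [C] and p x lies in [C]. Otherwise q x = 1 - p has the unit 1
   - a as its constant term. *)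
have [Ma|nMa] := EM (M a); last first.
  rewrite pE in Cp; have [Cpi p0] := Cunit _ _ Aa nMa Mb Cp; apply: nCx.
  rewrite -(mulKf p0 x); apply: (subringM hC) => //; rewrite -pE; exact: Jp.
have qx : q * x = (1 - a) + (- b) * x.
  transitivity (1 - p); last by rewrite pE; ring.
  by rewrite {1}pq; ring.
have Cqx : C (q * x) := Jq x Ix.
have Mb' : M (- b) by apply: submoduleN hMA _.
rewrite qx in Cqx.
have [Cqxi qx0] := Cunit _ _ (subringB hA A1 Aa) (local_1B Ma) Mb' Cqx.
rewrite -qx in Cqxi.
have q0 : q != 0 by apply: contra_neq qx0 => q0; rewrite -qx q0 mul0r.
have Cxi : C x^-1.
  have -> : x^-1 = q * (q * x)^-1 by rewrite invfM mulVKf.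
  by apply: (subringM hC).
have [r' [s [Ar Ms xi]]] := CE _ Cxi.
have [Mr|nMr] := EM (M r'); last first.
  rewrite xi in Cxi; have [+ _] := Cunit _ _ Ar nMr Ms Cxi.
  by rewrite -xi invrK.
(* Now x^-1 = r' + s x gives s x^2 = 1 - r' x, a unit of [B]. Thus 1 is s times an element of [B],
   and a power of it would lie in [M]. *)
have [n Mn] := overring_pow oB (submoduleN hA hMA Mr) Bx.
have [Bu u0] : B (1 + - r' * x)^-1 /\ 1 + - r' * x != 0.
  apply: (unit_add_nilp hB AB A1 M1 _ Mn).
  by apply: (subringM hB) => //; apply/AB/(subringN hA).
have [k] : exists n, M ((s * (x * x * (1 + - r' * x)^-1)) ^+ n).
  by apply: (overring_pow oB Ms); do 2 apply: (subringM hB) => //.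
suff -> : s * (x * x * (1 + - r' * x)^-1) = 1 by rewrite expr1n.
apply: (mulIf u0); rewrite mul1r -!mulrA mulVf// mulr1.
have : x * x^-1 = 1 by rewrite mulfV.
rewrite xi => e; rewrite -e; ring.
Qed.

(** * Maximal ideals and Jacobson radical of a fractional overring *)

Section Overring.

Variable B : set K.
Hypothesis oB : frac_overring A B.

Let hB : subring B. Proof. by case: oB. Qed.
Let AB : A `<=` B. Proof. by case: oB. Qed.

Lemma maximal_meet N a : maximal_ideal B N -> A a -> N a -> M a.
Proof.
move=> hN Aa Na; apply: contrapT => nMa.
by apply: (maximal_unit hN _ _ Na); [apply/AB/Aunit|apply: Mneq].
Qed.

(** Otherwise some 1 - b m lies in [N]; but b m has a power in [M], so 1 - b m is a unit of [B]. *)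
Lemma sub_maximal N : maximal_ideal B N -> M `<=` N.
Proof.
move=> hN m Mm; apply: contrapT => nNm.
have Bm := AB (MA Mm).
have [b Bb Nb] := maximal_comax hB hN Bm nNm.
have [n Mn] := overring_pow oB (submoduleN hA hMA Mm) Bb.
have [|Bu u0] := unit_add_nilp hB AB (subring1 hA) M1 _ Mn.
  by apply: (subringM hB) => //; apply: (subringN hB).
apply: (maximal_unit hN Bu u0).
by move: Nb; congr (N _); ring.
Qed.

(** Multiplying the quadratic relation p^-2 = a + b p^-1 by p writes p^-1 as a p + b. *)
Lemma subring_inv C p :
  subring C -> A `<=` C -> C p -> p != 0 -> B p^-1 -> C p^-1.
Proof.
move=> hC AC Cp p0 Bpi; have [a [b [Aa Ab e]]] := overring_quadratic oB Bpi.
have -> : p^-1 = a * p + b by rewrite -[LHS](mulfVK p0) e mulrDl mulfVK.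
by apply: (subringD hC); [apply: (subringM hC) => //|]; apply: AC.
Qed.

Lemma crt3 N1 N2 N3 : maximal_ideal B N1 -> maximal_ideal B N2 ->
    maximal_ideal B N3 -> N2 <> N1 -> N3 <> N1 ->
  exists e, [/\ B e, N1 (1 - e), N2 e & N3 e].
Proof.
move=> h1 h2 h3 n21 n31.
have [x [Bx x2 x1]] := maximal_comax2 hB h1 h2 n21.
have [y [By y3 y1]] := maximal_comax2 hB h1 h3 n31.
exists (x * y); split.
- exact: (subringM hB).
- have -> : 1 - x * y = (1 - x) + x * (1 - y) by ring.
  apply: (submoduleD (maximal_submodule h1)) => //.
  exact: (submoduleM (maximal_submodule h1)).
- exact: (submoduleMr (maximal_submodule h2)).
- exact: (submoduleM (maximal_submodule h3)).
Qed.

(* Modulo the [Ni], the ideal [I = A e + A f + A g] becomes the plane spanned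
   by (1, 1, 0) and (0, 1, 1), so that its endomorphism ring becomes diagonal;
   no three products [e p], [f q], [g r] in it can then sum up to 1. *)
Lemma no_three_maximal N1 N2 N3 : maximal_ideal B N1 -> maximal_ideal B N2 ->
  maximal_ideal B N3 -> N1 <> N2 -> N1 <> N3 -> N2 <> N3 -> False.
Proof.
move=> h1 h2 h3 n12 n13 n23.
have s1 := maximal_submodule h1; have s2 := maximal_submodule h2.
have s3 := maximal_submodule h3.
have [e1 [Be1 e11 e12 e13]] := crt3 h1 h2 h3 (nesym n12) (nesym n13).
have [e2 [Be2 e22 e21 e23]] := crt3 h2 h1 h3 n12 (nesym n23).
have [e3 [Be3 e33 e31 e32]] := crt3 h3 h1 h2 n13 n23.
(* Modulo N1, N2, N3 these are (1, 1, 0), (0, 1, 1) and (0, 0, 0). The choice of [g] gives 1 = e + f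
   - e f + g, which puts [C] and (C : I) inside [B]. *)
pose e := e1 + e2; pose f := e2 + e3; pose g := (1 - e) * (1 - f).
have Be : B e by apply: (subringD hB).
have Bf : B f by apply: (subringD hB).
have B1e : B (1 - e) by apply: (subringB hB) => //; apply: subring1.
have B1f : B (1 - f) by apply: (subringB hB) => //; apply: subring1.
have Bg : B g by apply: (subringM hB).
have N1e : N1 (1 - e).
  by have := submoduleB hB s1 e11 e21; congr (N1 _); rewrite /e; ring.
have N1f : N1 f by apply: (submoduleD s1).
have N1g : N1 g by apply: (submoduleMr s1).
have N2e : N2 (1 - e).
  by have := submoduleB hB s2 e22 e12; congr (N2 _); rewrite /e; ring.
have N2f : N2 (1 - f).
  by have := submoduleB hB s2 e22 e32; congr (N2 _); rewrite /f; ring.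
have N2g : N2 g by apply: (submoduleMr s2).
have N3e : N3 e by apply: (submoduleD s3).
have N3f : N3 (1 - f).
  by have := submoduleB hB s3 e33 e23; congr (N3 _); rewrite /f; ring.
have N3g : N3 g by apply: (submoduleM s3).
have e0 : e != 0.
  apply/eqP => e0; apply: (maximal_1 h1).
  by move: N1e; rewrite e0 subr0.
have := gen3_stable hA cA oB Be Bf Bg e0.
set I := gen3 A e f g; move=> /= [fI Ie If Ig [p [q [r [Jp Jq Jr pqr]]]]].
have oC := endo_overring hA fI; move: Jp Jq Jr oC; set C := endo_ring I.
move=> Jp Jq Jr oC.
have IB t : I t -> B t.
  move=> [a [b [c [/AB Ba /AB Bb /AB Bc ->]]]].
  by do 2?apply: (subringD hB) => //; apply: (subringM hB).
have B_of c : B (c * e) -> B (c * f) -> B (c * g) -> B c.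
  move=> ce cf cg; have -> : c = c * e + c * f - c * e * f + c * g.
    by rewrite /g; ring.
  apply: (subringD hB) => //; apply: (subringB hB); first exact: (subringD hB).
  exact: (subringM hB).
have CB c : C c -> B c by move=> Cc; apply: B_of; apply/IB/Cc.
have JB c : colon C I c -> B c by move=> Jc; apply: B_of; apply/CB/Jc.
(* Reading c e at N3 and c f at N1 puts b and a' in [M]. So c is a modulo N1 and N2, and b' modulo
   N2 and N3; comparing at N2 gives a = b' modulo [M]. *)
have diag c : C c -> exists2 a, A a & [/\ N1 (c - a), N2 (c - a) & N3 (c - a)].
  move=> Cc; have Bc := CB _ Cc.
  have [a [b [d [Aa Ab Ad ce]]]] := Cc e Ie.
  have [a' [b' [d' [Aa' Ab' Ad' cf]]]] := Cc f If.
  have [[Ba Bb] Bd] := (AB Aa, AB Ab, AB Ad).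
  have [[Ba' Bb'] Bd'] := (AB Aa', AB Ab', AB Ad').
  have Mb : M b.
    apply: (maximal_meet h3 Ab).
    have -> : b = b * (1 - f) + (c - a) * e - d * g.
      by rewrite [_ * e]mulrBl ce; ring.
    apply: (submoduleB hB s3); last exact: (submoduleM s3).
    by apply: (submoduleD s3); apply: (submoduleM s3) => //;
      apply: (subringB hB).
  have Ma' : M a'.
    apply: (maximal_meet h1 Aa').
    have -> : a' = a' * (1 - e) + (c - b') * f - d' * g.
      by rewrite [_ * f]mulrBl cf; ring.
    apply: (submoduleB hB s1); last exact: (submoduleM s1).
    by apply: (submoduleD s1); apply: (submoduleM s1) => //;
      apply: (subringB hB).
  have caE : c - a = (c - a) * (1 - e) + b * f + d * g.
    by rewrite mulrBr mulr1 [_ * e]mulrBl ce; ring.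
  have cbE : c - b' = (c - b') * (1 - f) + a' * e + d' * g.
    by rewrite mulrBr mulr1 [_ * f]mulrBl cf; ring.
  have Bca : B (c - a) by apply: (subringB hB).
  have Bcb : B (c - b') by apply: (subringB hB).
  have N2ca : N2 (c - a).
    rewrite caE; do 2?apply: (submoduleD s2); try exact: (submoduleM s2).
    by apply: (submoduleMr s2) => //; apply: (sub_maximal h2).
  have N2cb : N2 (c - b').
    rewrite cbE; do 2?apply: (submoduleD s2); try exact: (submoduleM s2).
    by apply: (submoduleMr s2) => //; apply: (sub_maximal h2).
  have N3cb : N3 (c - b').
    by rewrite cbE; do 2?apply: (submoduleD s3); apply: (submoduleM s3).
  have Mab : M (a - b').
    apply: (maximal_meet h2); first exact: (subringB hA).
    by have := submoduleB hB s2 N2cb N2ca; congr (N2 _); ring.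
  exists a => //; split=> //.
    rewrite caE; do 2?apply: (submoduleD s1); exact: (submoduleM s1).
  have -> : c - a = (c - b') - (a - b') by ring.
  by apply: (submoduleB hB s3) => //; apply: (sub_maximal h3).
(* If c lies in one of the three ideals, its common residue a lies in [M], so c lies in N1. This is
   needed for p e, which is in N3; q f and r g are in N1. *)
have collapse c : C c -> N1 c \/ N2 c \/ N3 c -> N1 c.
  move=> Cc Nc; have [a Aa [d1 d2 d3]] := diag c Cc.
  suff Ma : M a by rewrite -(subrK a c); apply: (submoduleD s1) => //;
    apply: (sub_maximal h1).
  have [Nc1|[Nc2|Nc3]] := Nc.
  - by apply: (maximal_meet h1 Aa); rewrite -(subKr c a);
    apply: (submoduleB hB s1).
  - by apply: (maximal_meet h2 Aa); rewrite -(subKr c a);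
    apply: (submoduleB hB s2).
  - by apply: (maximal_meet h3 Aa); rewrite -(subKr c a);
    apply: (submoduleB hB s3).
apply: (maximal_1 h1); rewrite pqr.
apply: (submoduleD s1); [apply: (submoduleD s1)|]; apply: collapse.
- exact: Jp.
- by right; right; apply: (submoduleM s3) => //; apply: JB.
- exact: Jq.
- by left; apply: (submoduleM s1) => //; apply: JB.
- exact: Jr.
- by left; apply: (submoduleM s1) => //; apply: JB.
Qed.

(** [N'] may be [N] itself, which covers the case of a single maximal ideal. *)
Lemma two_maximal N : maximal_ideal B N -> exists2 N', maximal_ideal B N' &
  forall Q, maximal_ideal B Q -> Q = N \/ Q = N'.
Proof.
move=> hN; have [[N' [hN' neqN]]|noN] := EM (exists N',
  maximal_ideal B N' /\ N <> N').
  exists N' => // Q hQ; apply: contrapT => /not_orP[QN QN'].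
  exact: (no_three_maximal hN hN' hQ neqN (nesym QN) (nesym QN')).
exists N => // Q hQ; left; apply: contrapT => QN; apply: noN; exists Q.
by split=> // /esym.
Qed.

Definition jacobson : set K :=
  [set x | B x /\ forall N, maximal_ideal B N -> N x].

(** In 1 = p + q x + r y the element p avoids all maximal ideals, so it is a unit of [B] and, by
    [subring_inv], of [C]. As p I lies in [C], so does I; in particular x is an endomorphism of
    I. *)
Lemma jacobson_mul x y : jacobson x -> jacobson y ->
  exists a b c, [/\ A a, A b, A c & x * y = a + b * x + c * y].
Proof.
move=> [Bx Nx] [By Ny]; have B1 := subring1 hB.
have := gen3_stable hA cA oB B1 Bx By (oner_neq0 K).
set I := gen3 A 1 x y; move=> /= [fI I1 Ix Iy [p [q [r [Jp Jq Jr pqr]]]]].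
have oC := endo_overring hA fI; move: Jp Jq Jr oC; set C := endo_ring I.
move=> Jp Jq Jr [hC AC _].
have CI c : C c -> I c by move=> /(_ 1 I1); rewrite mulr1.
have IB t : I t -> B t.
  move=> [a [b [c [/AB Ba /AB Bb /AB Bc ->]]]].
  by do 2?apply: (subringD hB) => //; apply: (subringM hB).
have JC c : colon C I c -> C c by move=> Jc; rewrite -(mulr1 c); apply: Jc.
have JB c : colon C I c -> B c by move=> /JC/CI/IB.
have Np N : maximal_ideal B N -> ~ N p.
  move=> hN Np; have sN := maximal_submodule hN.
  apply: (maximal_1 hN); rewrite pqr mulr1.
  by do 2?apply: (submoduleD sN) => //; apply: (submoduleM sN);
    first [exact: JB|exact: Nx|exact: Ny].
have p0 : p != 0.
  apply/eqP => p0; have [N hN] := exists_maximal hB.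
  by apply: (Np N hN); rewrite p0; apply: (submodule0 (maximal_submodule hN)).
have Cpi : C p^-1.
  by apply: subring_inv => //; [apply: JC|apply: unit_of_no_maximal => //;
    apply: JB].
have IC t : I t -> C t.
  by move=> It; rewrite -(mulKf p0 t); apply: (subringM hC) => //; apply: Jp.
have [a [b [c [Aa Ab Ac e]]]] := IC _ Ix _ Iy.
by exists a, b, c; split=> //; rewrite e mulr1.
Qed.

Lemma jacobson_unit x b : jacobson x -> A b -> ~ M b -> B (x - b)^-1 /\ x - b
  != 0.
Proof.
move=> [Bx Nx] Ab nMb.
have nN N : maximal_ideal B N -> ~ N (x - b).
  move=> hN Nxb; apply/nMb/(maximal_meet hN Ab); rewrite -(subKr x b).
  by apply: (submoduleB hB (maximal_submodule hN)) => //; apply: Nx.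
have xb0 : x - b != 0.
  apply/eqP => xb0; have [N hN] := exists_maximal hB.
  by apply: (nN N hN); rewrite xb0; apply: (submodule0 (maximal_submodule hN)).
split=> //; apply: (unit_of_no_maximal hB) => //.
by apply: (subringB hB) => //; apply: AB.
Qed.

(** In x y = a + b x + c y the term a lies in [M]. If c is a unit, then y = (a + b x) / (x - c) with
    x - c a unit of [B], which reduces x y to x^2; squares are treated alike through
    [overring_quadratic]. *)
Lemma jacobson_sq x y : jacobson x -> jacobson y -> ideal_mul M B (x * y).
Proof.
(* In [submodule_ideal_mul] scalars act on the left factor, hence the work in [B] [M] rather than
   [M] [B]. *)
have sMB : submodule B (ideal_mul B M) :=
  submodule_ideal_mul _ (subring_submodule hB).
have comm : ideal_mul B M `<=` ideal_mul M B.
  move=> z [n [a [b [Ba Mb ->]]]]; exists n, b, a; split=> //.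
  by apply: eq_bigr => i _; rewrite mulrC.
have inMB b m : B b -> M m -> ideal_mul B M (b * m) by apply: ideal_mul_in.
have [N0 hN0] := exists_maximal hB; have sN0 := maximal_submodule hN0.
have sq z : jacobson z -> ideal_mul B M (z * z).
  move=> Jz; have [Bz Nz] := Jz;
    have [a [b [Aa Ab e]]] := overring_quadratic oB Bz.
  have Ma : M a.
    apply: (maximal_meet hN0 Aa);
      have -> : a = (z - b) * z by rewrite mulrBl e; ring.
    by apply: (submoduleM sN0); [apply: (subringB hB) => //;
      apply: AB|apply: Nz].
  have [Mb|nMb] := EM (M b).
    rewrite e -(mul1r a) (mulrC b).
    by apply: (submoduleD sMB); apply: inMB => //; apply: subring1.
  have [Bu u0] := jacobson_unit Jz Ab nMb.
  have -> : z * z = (z * (z - b)^-1) * a.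
    have zE : z = a / (z - b) by apply: (canRL (mulfK u0)); rewrite mulrBr e;
      ring.
    by rewrite {2}zE; ring.
  by apply: inMB => //; apply: (subringM hB).
move=> Jx Jy; apply: comm; have [Bx Nx] := Jx; have [By Ny] := Jy.
have [a [b [c [Aa Ab Ac e]]]] := jacobson_mul Jx Jy.
have Ma : M a.
  apply: (maximal_meet hN0 Aa);
    have -> : a = x * y - b * x - c * y by rewrite e; ring.
  have [Nx0 Ny0] := (Nx _ hN0, Ny _ hN0).
  by do 2?apply: (submoduleB hB sN0); apply: (submoduleM sN0) => //; apply: AB.
have half u v b' c' : jacobson u -> jacobson v -> A b' -> A c' -> ~ M c' ->
    u * v = a + b' * u + c' * v -> ideal_mul B M (u * v).
  move=> Ju Jv Ab' Ac' nMc uv; have [Bw w0] := jacobson_unit Ju Ac' nMc.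
  have [Bu _] := Ju.
  have -> : u * v = (u * (u - c')^-1) * a + (b' * (u - c')^-1) * (u * u).
    have vE : v = (a + b' * u) / (u - c').
      by apply: (canRL (mulfK w0)); rewrite mulrBr (mulrC v u) uv; ring.
    by rewrite {1}vE; ring.
  apply: (submoduleD sMB); first by apply: inMB => //; apply: (subringM hB).
  apply: (submoduleM sMB); last exact: sq.
  by apply: (subringM hB) => //; apply: AB.
have [Mc|nMc] := EM (M c); last exact: (half _ _ b c).
have [Mb|nMb] := EM (M b); last first.
  by rewrite mulrC; apply: (half _ _ c b) => //; rewrite mulrC e; ring.
rewrite e -(mul1r a) (mulrC b) (mulrC c).
by do 2?apply: (submoduleD sMB); apply: inMB => //; apply: subring1.
Qed.

End Overring.

(** * Principal ideals, and the passage from [M] to all ideals *)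

Lemma trace_strongly_stable I :
  frac_ideal A I -> trace_ideal I 1 -> strongly_stable_ideal I.
Proof.
move=> fI [n [u [v [Iu Jv uv]]]]; split; first exact: frac_endo fI.
have oC := endo_overring hA fI; have hI : submodule A I by case: fI.
move: Jv oC; set C := endo_ring I => Jv oC; have [hC AC _] := oC.
have hJ := submodule_colon I (subring_submodule hC).
have [N hN] := exists_maximal hC; have [N' hN' NN'] := two_maximal oC hN.
have pick Q : maximal_ideal C Q -> exists x y, [/\ I x,
  colon C I y & ~ Q (x * y)].
  move=> hQ; apply: contrapT => noxy; apply: (maximal_1 hQ); rewrite uv.
  apply: (submodule_sum (maximal_submodule hQ)) => i.
  by apply: contrapT => nQ; apply: noxy; exists (u i), (v i).
have [x [y [Ix Jy xy]]] := pick N hN;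
  have [x' [y' [Ix' Jy' xy']]] := pick N' hN'.
(* Avoidance of [N] and [N'] at once: if neither x nor x' works, then x (C : I) lies in [N'] and x'
   (C : I) in [N], so x + x' works. Then c (C : I) is all of [C], and c generates [I]. *)
have [c [Ic [d [Jd cd]] [d' [Jd' cd']]]] : exists c, [/\ I c,
    exists y, colon C I y /\ ~ N (c * y) & exists y,
      colon C I y /\ ~ N' (c * y)].
  have [[z [Jz xz]]|no1] := EM (exists z, colon C I z /\ ~ N' (x * z)).
    by exists x; split=> //; [exists y|exists z].
  have [[z [Jz xz]]|no2] := EM (exists z, colon C I z /\ ~ N (x' * z)).
    by exists x'; split=> //; [exists z|exists y'].
  have sN := maximal_submodule hN; have sN' := maximal_submodule hN'.
  exists (x + x'); split; first exact: submoduleD hI _ _.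
    exists y; split=> //; rewrite mulrDl => Nxy; apply: xy.
    rewrite -(addrK (x' * y) (x * y)); apply: (submoduleB hC sN) => //.
    by apply: contrapT => nN; apply: no2; exists y.
  exists y'; split=> //; rewrite mulrDl => Nxy; apply: xy'.
  rewrite -(addKr (x * y') (x' * y')) addrC; apply: (submoduleB hC sN') => //.
  by apply: contrapT => nN; apply: no1; exists y'.
have hT : integral_ideal C [set c * z | z in colon C I].
  split; last by move=> _ [z Jz <-]; rewrite mulrC; apply: Jz.
  split=> [|_ _ [z Jz <-] [t Jt <-]|a _ Ca [z Jz <-]].
  - by exists 0; rewrite ?mulr0//; apply: submodule0 hJ.
  - by exists (z + t); rewrite ?mulrDr//; apply: submoduleD hJ _ _.
  - by exists (a * z); rewrite 1?mulrCA//; apply: submoduleM hJ _ _.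
have [t Jt ct] : [set c * z | z in colon C I] 1.
  apply: contrapT => nT; have [Q hQ TQ] := maximal_ideal_above hC hT nT.
  have [QE|QE] := NN' Q hQ; rewrite QE in TQ.
    by apply: cd; apply: TQ; exists d.
  by apply: cd'; apply: TQ; exists d'.
exists c; apply/seteqP; split=> [z Iz|_ [a Ca <-]].
  by exists (t * z); [apply: Jt|rewrite mulrA ct mul1r].
by rewrite mulrC; apply: Ca.
Qed.

(** The trace ideal is proper, so it lies in a maximal ideal, and [clifford_trace] applies. *)
Lemma maximal_absorb I : frac_ideal A I -> ~ trace_ideal I 1 ->
  exists2 N, maximal_ideal (endo_ring I) N & I `<=` ideal_mul I N.
Proof.
move=> fI nT; have [hC _ _] := endo_overring hA fI.
have [N hN TN] := maximal_ideal_above hC (trace_integral hA fI) nT.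
exists N => //; apply: subset_trans (clifford_trace cA fI) _.
exact: ideal_mulS.
Qed.

Lemma frac_overring_sub B I : frac_overring A B -> submodule B I -> I `<=` B ->
  (exists2 x, I x & x != 0) -> frac_ideal A I.
Proof.
by move=> oB hI IB; apply: (frac_sub oB) => //; have [_ AB _] := oB;
  apply: submodule_sub hI.
Qed.

Lemma frac_max : frac_ideal A M.
Proof.
apply: (frac_overring_sub (B := A)) => //; split=> //.
by exists 1; split=> // [||x]; [exact: subring1|exact: oner_neq0|rewrite mul1r].
Qed.

Lemma trace_of_max I : trace_ideal M 1 -> frac_ideal A I -> trace_ideal I 1.
Proof.
move=> tM fI; have fM := frac_max; have oE := endo_overring hA fM.
have [_ [m Mm]] := trace_strongly_stable fM tM.
apply: contrapT => nT; have [N hN IN] := maximal_absorb fI nT.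
have oC := endo_overring hA fI; have hI : submodule A I by case: fI.
have hCI := endo_submodule hI.
move: hN oC hCI; set C := endo_ring I => hN oC hCI; have [hC AC _] := oC.
have sN := maximal_submodule hN; have NC := maximal_sub hN.
(* s is taken in the second maximal ideal and outside [N], or equal to 1 if [N] is the only one. *)
have [s [Cs nNs sNJ]] : exists s, [/\ C s, ~ N s &
    forall x, N x -> jacobson C (s * x)].
  have [N' hN' NN'] := two_maximal oC hN.
  have sN' := maximal_submodule hN'.
  have [NeqN'|NneqN'] := EM (N' = N).
    exists 1; split; [exact: subring1|exact: maximal_1 hN|move=> x Nx].
    rewrite mul1r; split; first exact: NC.
    by move=> Q /NN'; rewrite NeqN' => -[->|->].
  have [s [Cs N's Ns1]] := maximal_comax2 hC hN hN' NneqN'.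
  exists s; split=> // [Ns|x Nx].
    by apply: (maximal_1 hN); rewrite -(subrK s 1); apply: (submoduleD sN).
  split; first by apply: (subringM hC) => //; apply: NC.
  move=> Q /NN'[->|->]; first exact: (submoduleM sN).
  by apply: (submoduleMr sN') => //; apply: NC.
have hMI : submodule A (ideal_mul M I) by apply: submodule_ideal_mul.
(* Using I = I N twice, s^2 I lies in I (s N) (s N), and [jacobson_sq] puts the last two factors in
   M C. *)
have ssI i : I i -> ideal_mul M I (s * s * i).
  move=> /IN; apply: (ideal_mul_sub (submodule_preim _ hMI)) => {}i x Ii Nx /=.
  move/IN: Ii; rewrite mulrCA mulrC.
  move: i; apply: (ideal_mul_sub (submodule_preim _ hMI)) => i y Ii Ny /=.
  have -> : s * s * x * (i * y) = i * ((s * x) * (s * y)) by ring.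
  have := jacobson_sq oC (sNJ _ Nx) (sNJ _ Ny); move: (s * x * (s * y)).
  apply: (ideal_mul_sub (submodule_preim _ hMI)) => m' c Mm' Cc /=.
  by rewrite mulrCA; apply: ideal_mul_in => //; rewrite mulrC; apply: Cc.
have m0 : m != 0.
  by have [x Mx] := Mneq0; apply: contra_neq => m0; move: Mx;
    rewrite Mm => -[a _ <-]; rewrite m0 mul0r.
have Mmm : M m.
  by rewrite Mm; exists 1; rewrite ?mulr1//; have [hE _ _] := oE;
    apply: subring1.
(* Since M = m E(M), extending [I] to E(M) makes s^2 / m an endomorphism. *)
pose I1 := ideal_mul I (endo_ring M).
have fI1 : frac_ideal A I1 by apply: frac_mul.
have hI1 : submodule A I1 by case: fI1.
pose b := s * s / m.
have Bb : endo_ring I1 b.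
  apply: (ideal_mul_sub (submodule_preim _ hI1)) => i e Ii Ee /=.
  have -> : b * (i * e) = e / m * (s * s * i) by rewrite /b; ring.
  move: (ssI i Ii); apply: (ideal_mul_sub (submodule_preim _ hI1)) =>
    m' j + Ij /=.
  rewrite Mm => -[e' Ee' <-].
  have -> : e / m * (m * e' * j) = j * (e * e') by field.
  by apply: ideal_mul_in => //; have [hE _ _] := oE; apply: (subringM hE).
have [al [be [Aal Abe bb]]] := overring_quadratic (endo_overring hA fI1) Bb.
(* Multiplying b^2 = al + be b by m^2 shows that m divides s^4 in [C], and m lies in [N]. *)
have Nss : N (s * s * (s * s)).
  have -> : s * s * (s * s) = m * (m * al + be * (s * s)).
    transitivity (m * m * (b * b)); first by rewrite /b; field.
    by rewrite bb /b; field.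
  have Nm : N m by apply: (sub_maximal oC hN).
  apply: (submoduleMr sN) => //; apply: (subringD hC); apply: (subringM hC).
  - exact/AC/MA.
  - exact: AC.
  - exact: AC.
  - exact: (subringM hC).
have Css : C (s * s) by apply: (subringM hC).
by case: (maximal_prime hC hN Css Css Nss) => /(maximal_prime hC hN Cs Cs) [].
Qed.

(** * Maximal and t-maximal ideals *)

Lemma maximal_proper_t B N :
  frac_overring A B -> maximal_ideal B N -> proper_t_ideal B N.
Proof.
move=> oB hN; have [hB AB _] := oB.
have sN := maximal_submodule hN; have NB := maximal_sub hN.
have fB J : submodule B J -> J `<=` N -> (exists2 x, J x & x != 0) ->
    frac_ideal B J.
  move=> hJ JN Jnz; split=> //; exists 1; split;
    [exact: subring1|exact: oner_neq0|].
  by move=> x /JN/NB; rewrite mul1r.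
have [m Mm m0] := Mneq0; have Nm := sub_maximal oB hN Mm.
split; [by apply: fB => //; exists m|by case: hN|apply/seteqP;
  split=> [x Nx|x]].
  have h0 : submodule B [set 0].
    by split=> [//|_ _ -> ->|a _ _ ->]; rewrite ?addr0 ?mulr0.
  have h1 := submodule_adjoin m hB h0; have h2 := submodule_adjoin x hB h1.
  (* The generator m keeps the ideal nonzero even if x = 0. *)
  exists (adjoin B (adjoin B [set 0] m) x); split.
  - apply: fB => //.
      by do 2?apply: (adjoin_sub sN) => //; move=> _ ->; apply: submodule0 sN.
    by exists m => //; apply: sub_adjoin => //; apply: adjoin_in.
  - do 2 apply: fin_gen_adjoin; exact: fin_gen0.
  - by do 2?apply: (adjoin_sub sN) => //; move=> _ ->; apply: submodule0 sN.
  - by move=> y Jy; rewrite mulrC; apply/Jy/adjoin_in.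
move=> [J [[hJ [j Jj j0] _] fgJ JN vJ]].
have Bx : B x.
  by rewrite -(mulr1 x); apply: vJ => y /JN/NB; rewrite mul1r.
(* Enlarge [J] by 1 - b x, inside [N]. Whatever multiplies the larger ideal into [B] does so to 1 -
   b x and, as x is in the v-closure of [J], to x; so it lies in [B]. Stability then puts 1 in the
   larger ideal. *)
apply: contrapT => nNx; have [b Bb Nbx] := maximal_comax hB hN Bx nNx.
have hJ2 := submodule_adjoin (1 - b * x) hB hJ.
have J2N : adjoin B J (1 - b * x) `<=` N by apply: adjoin_sub.
have JJ2 : J `<=` adjoin B J (1 - b * x) by apply: sub_adjoin.
apply: (maximal_1 hN); apply: (J2N); apply: (trace_colon_sub hB) => //.
- by move=> y /J2N/NB.
- apply: (fin_gen_stable hA cA oB); last exact: fin_gen_adjoin.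
  by apply: fB => //; exists j => //; apply: JJ2.
- move=> y Jy; have -> : y = y * (1 - b * x) + b * (x * y) by ring.
  apply: (subringD hB); first by apply/Jy/adjoin_in.
  by apply: (subringM hB) => //; apply: vJ => z /JJ2; apply: Jy.
Qed.

Lemma maximal_t_maximal B N :
  frac_overring A B -> maximal_ideal B N -> t_maximal B N.
Proof.
move=> oB hN; split=> [|Q [[hQ _ _] QB _] NQ]; first exact: maximal_proper_t.
by have [_ _ maxN] := hN; apply: maxN => //; split=> //; case: QB.
Qed.

(** A maximal ideal above [N] is a proper t-ideal, so it equals [N]. *)
Lemma t_maximal_maximal B N :
  frac_overring A B -> t_maximal B N -> maximal_ideal B N.
Proof.
move=> oB [[[hN _ _] [NB BN] _] maxN]; have [hB _ _] := oB.
have [//| |Q hQ NQ] := @maximal_ideal_above _ B N hB.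
  by move=> N1; apply: BN => x Bx; rewrite -(mulr1 x); apply: submoduleM hN _ _.
by rewrite -(maxN Q) //; apply: maximal_proper_t.
Qed.

Lemma maximal_divisorial B N : (forall I, frac_ideal A I -> trace_ideal I 1) ->
  frac_overring A B -> maximal_ideal B N -> divisorial B N.
Proof.
move=> tA oB hN; have [hB AB _] := oB.
have sN := maximal_submodule hN; have NB := maximal_sub hN.
apply/(divisorial_maximal hB hN) => JB; apply: (maximal_1 hN).
apply: (trace_colon_sub hB) => //; apply: tA.
apply: (frac_overring_sub oB) => //.
by have [m Mm m0] := Mneq0; exists m => //; apply: (sub_maximal oB hN).
Qed.

Lemma max_trace_of_divisorial :
  (forall N, maximal_ideal (endo_ring M) N -> divisorial (endo_ring M) N) ->
  trace_ideal M 1.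
Proof.
move=> dE; apply: contrapT => nT; have fM := frac_max.
have [hE _ _] := endo_overring hA fM.
have [N hN MN] := maximal_absorb fM nT.
apply: (divisorial_maximal hE hN).1 (dE N hN) _ => y Jy m /MN.
apply: (ideal_mul_sub (submodule_preim _ hMA)) => {}m n Mm Nn /=.
by rewrite mulrCA mulrC; apply: Jy.
Qed.

End LocalOneDim.

(** * Local domains of Krull dimension one *)

Section KrullDimOne.

Variables (K : fieldType) (A M : set K).
Hypotheses (hA : subring A) (hloc : local_with A M) (hdim : has_krull_dim A 1).

Let hM : maximal_ideal A M. Proof. by case: hloc. Qed.

Lemma local_unit a : A a -> ~ M a -> A a^-1.
Proof.
move=> Aa nMa; apply: (unit_of_no_maximal hA) => // [|N hN].
  by apply/eqP => a0; apply: nMa; rewrite a0;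
    apply: submodule0 (maximal_submodule hM).
by have [_ uM] := hloc; rewrite (uM N hN).
Qed.

Lemma local_proper P : submodule A P -> P `<=` A -> ~ P 1 -> P `<=` M.
Proof.
move=> hP PA P1 x Px; apply: contrapT => nMx; apply: P1.
have x0 : x != 0.
  by apply/eqP => x0; apply: nMx; rewrite x0;
    apply: submodule0 (maximal_submodule hM).
rewrite -(mulVf x0); apply: (submoduleM hP) => //.
by apply: local_unit => //; apply: PA.
Qed.

Lemma dim1_max_neq0 : exists2 m, M m & m != 0.
Proof.
have [[c [cP /(_ 0%N isT)[c01 c10]]] _] := hdim.
have [[[h0 _] _ _] [[h1 c1A] [_ Ac1] _]] := (cP 0%N isT, cP 1%N isT).
have [m c1m c0m] : exists2 m, c 1%N m & ~ c 0%N m.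
  apply: contrapT => no; apply: c10 => m c1m; apply: contrapT => c0m.
  by apply: no; exists m.
exists m; last by apply/eqP => m0; apply: c0m; rewrite m0; apply: submodule0 h0.
apply: (local_proper h1) => // c1; apply: Ac1 => x Ax.
by rewrite -(mulr1 x); apply: submoduleM h1 _ _.
Qed.

(** Otherwise an ideal maximal among those containing d and avoiding the powers of b is prime, and
    sits strictly between 0 and [M], which gives a prime chain of length 2. *)
Lemma dim1_radical b d : M b -> A d -> d != 0 ->
  exists n, exists2 a, A a & b ^+ n = d * a.
Proof.
move=> Mb Ad d0; apply: contrapT => nbd.
have Ab : A b by apply: (maximal_sub hM).
have hI : integral_ideal A [set d * a | a in A].
  split; last by move=> _ [a Aa <-]; apply: (subringM hA).
  split=> [|_ _ [x Ax <-] [y Ay <-]|a _ Aa [x Ax <-]].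
  - by exists 0; rewrite ?mulr0//; apply: subring0.
  - by exists (x + y); rewrite ?mulrDr//; apply: subringD.
  - by exists (a * x); rewrite 1?mulrCA//; apply: subringM.
have [|P [[hP PA] IP SP maxP]] :=
    @zorn_ideal _ A [set b ^+ n | n in setT] _ hA hI.
  by move=> _ [n _ <-] [a Aa dn]; apply: nbd; exists n, a.
have P1 : ~ P 1 by apply: SP; exists 0%N.
(* By maximality, adjoining x to [P] captures a power of b. *)
have absorb x : A x -> ~ P x -> exists n c, A c /\ P (b ^+ n - c * x).
  move=> Ax nPx; apply: contrapT => no; apply: nPx.
  rewrite -(maxP (adjoin A P x)); first exact: adjoin_in.
  - split; first exact: submodule_adjoin.
    by apply: (adjoin_sub (subring_submodule hA)).
  - exact: sub_adjoin.
  - by move=> _ [n _ <-] [c Ac Pc]; apply: no; exists n, c.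
have primeP : prime_ideal A P.
  split=> //; first by split=> // /(_ 1 (subring1 hA)).
  move=> x y Ax Ay Pxy; apply: contrapT => /not_orP[nPx nPy].
  have [n [c [Ac Pc]]] := absorb x Ax nPx;
    have [k [e [Ae Pe]]] := absorb y Ay nPy.
  apply: (SP (b ^+ (n + k))); first by exists (n + k)%N.
  have -> : b ^+ (n + k) = b ^+ k * (b ^+ n - c * x)
      + (c * x * (b ^+ k - e * y) + c * e * (x * y)) by rewrite exprD; ring.
  by do 2?apply: (submoduleD hP); apply: (submoduleM hP) => //;
     do ?apply: (subringM hA) => //; apply: subringX.
have sM := maximal_submodule hM.
have prime0 : prime_ideal A [set 0].
  split.
  - split=> [|_ ->]; last exact: subring0.
    by split=> [//|_ _ -> ->|a _ _ ->]; rewrite ?addr0 ?mulr0.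
  - split=> [_ ->|/(_ 1 (subring1 hA))/eqP]; first exact: subring0.
    by rewrite oner_eq0.
  - by move=> x y _ _ /= /eqP; rewrite mulf_eq0 => /orP[]/eqP; [left|right].
have primeM : prime_ideal A M.
  by case: (hM) => hM1 hM2 _; split=> // x y; apply: (maximal_prime hA hM).
pose c i := if i is j.+1 then (if j is _.+1 then M else P) else [set 0].
have [_ /(_ 2%N c)] := hdim; suff hc : prime_chain A 2 c by move=> /(_ hc).
split=> [[|[|i]]|[|[|i]]] // _; split.
- by move=> _ ->; apply: submodule0 hP.
- move=> P0; move/eqP: d0; apply; apply: P0; apply: IP.
  by exists 1; rewrite ?mulr1//; apply: subring1.
- exact: local_proper.
- by move=> /(_ b Mb); apply: SP; exists 1%N.
Qed.

End KrullDimOne.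

(** * Equivalence of the stability conditions *)

Theorem theorem3p3 (R : idomainType) (M : set {fraction R})
    (hloc : local_with (domain_in_frac R) M)
    (hdim : has_krull_dim (domain_in_frac R) 1) :
  let A := domain_in_frac R in
  let E := colon M M in
  [<-> stable A;
       strongly_stable A;
       clifford_regular A /\ stable_ideal M;
       clifford_regular A /\ (forall N, maximal_ideal E N -> divisorial E N);
       clifford_regular A /\ (forall N, t_maximal E N -> divisorial E N)].
Proof.
move=> A E.
have hA : subring A.
  split=> [|_ _ [x _ <-] [y _ <-]|_ _ [x _ <-] [y _ <-]].
  - by exists 1; rewrite ?tofrac1.
  - by exists (x - y); rewrite ?tofracB.
  - by exists (x * y); rewrite ?tofracM.
have [hM _] := hloc; have iM : integral_ideal A M by case: hM.
have M1 := maximal_1 hM; have Mnz := dim1_max_neq0 hA hloc hdim.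
have Aunit := local_unit hA hloc; have Arad := dim1_radical hA hloc hdim.
have fM : frac_ideal A M := frac_max hA iM Mnz.
have oE : frac_overring A E := endo_overring hA fM.
have traceP : stable A <-> forall I, frac_ideal A I -> trace_ideal I 1.
  by split=> sA I fI; apply/(stable_idealE hA fI)/sA.
have iiP : stable_ideal M <-> trace_ideal M 1 := stable_idealE hA fM.
(* Both the step from (ii) to (iii) and the return to (i) go through this spreading of stability
   from [M]. *)
have core : clifford_regular A -> trace_ideal M 1 ->
    forall I, frac_ideal A I -> trace_ideal I 1.
  by move=> cA tM I; apply: (trace_of_max hA iM M1 Mnz Aunit Arad cA tM).
tfae.
- move=> sA I fI; have cA := clifford_of_stable hA sA.
  by apply: (trace_strongly_stable hA iM M1 Aunit Arad cA fI);
    apply: (traceP.1 sA).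
- move=> sA; suff sA' : stable A.
    by split; [exact: clifford_of_stable|exact: sA'].
  apply/traceP => I fI; have [_ [c Ic]] := sA I fI.
  have [hC _ _] := endo_overring hA fI; have [_ [x Ix x0] _] := fI.
  have c0 : c != 0.
    by apply: contra_neq x0 => c0; move: Ix; rewrite Ic => -[a _ <-];
      rewrite c0 mul0r.
  (* As [I] = c E(I), the inverse of c lies in (E(I) : I). *)
  rewrite -(mulfV c0); apply: ideal_mul_in.
    by rewrite Ic; exists 1; [exact: subring1|rewrite mulr1].
  by move=> y; rewrite {1}Ic => -[a Ca <-]; rewrite mulKf.
- move=> [cA /iiP tM]; split=> // N hN.
  exact: (maximal_divisorial hA iM M1 Mnz Aunit Arad (core cA tM) oE hN).
- move=> [cA dE]; split=>
  // N /(t_maximal_maximal hA iM M1 Mnz Aunit Arad cA oE).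
  exact: dE.
- move=> [cA dE]; apply/traceP/(core cA).
  apply: (max_trace_of_divisorial hA iM Mnz cA) => N hN; apply: dE.
  exact: (maximal_t_maximal hA iM M1 Mnz Aunit Arad cA oE hN).
Qed.
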